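(* Let $n\ge 1$. The orthogonal projection $\mathcal{D}(M_n)\to\mathcal{D}(M_n(\mathbb{R}))$ is open.
   Context: $M_n$ is the algebra of complex $n\times n$ matrices, $M_n(\mathbb{R})\subset M_n$ the real algebra of real $n\times n$ matrices, $I_n$ the identity matrix, $A^*$ the conjugate transpose of $A$, and $\langle A,B\rangle:=\operatorname{tr}(A^*B)$. A real matrix system on $\mathbb{C}^n$ is a real linear subspace $\mathcal{R}\subset M_n$ such that $A^*\in\mathcal{R}$ for all $A\in\mathcal{R}$ and $I_n\in\mathcal{R}$; both $M_n$ and $M_n(\mathbb{R})$ are real matrix systems. For a real matrix system $\mathcal{R}$ put: $\mathcal{H}(\mathcal{R}):=\{A\in\mathcal{R}: A^*=A\}$; $\mathcal{C}(\mathcal{R})$ the cone of positive semidefinite matrices in $\mathcal{R}$; $\mathcal{C}(\mathcal{R})^\vee:=\{A\in\mathcal{H}(\mathcal{R}): \langle A,B\rangle\ge 0 \text{ for all } B\in\mathcal{C}(\mathcal{R})\}$; and $\mathcal{D}(\mathcal{R}):=\{\rho\in\mathcal{C}(\mathcal{R})^\vee:\operatorname{tr}(\rho)=1\}$. The orthogonal projection of $M_n$ onto $M_n(\mathbb{R})$ is the real linear map $\pi$ determined by $\operatorname{Re}\langle A-\pi(A),B\rangle=0$ for all $B\in M_n(\mathbb{R})$ (this is the entrywise real part). It maps $\mathcal{D}(M_n)$ into $\mathcal{D}(M_n(\mathbb{R}))$; its restriction $\mathcal{D}(M_n)\to\mathcal{D}(M_n(\mathbb{R}))$ is called the orthogonal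 projection of $\mathcal{D}(M_n)$ onto $\mathcal{D}(M_n(\mathbb{R}))$. Sets of matrices carry the relative Euclidean topology. A map $f:K\to L$ is open at $x\in K$ if the image of every neighborhood of $x$ in $K$ is a neighborhood of $f(x)$ in $L$; $f$ is open if it is open at every point of $K$. *)

(* Defs.v *)
From HB Require Import structures.
From mathcomp Require Import all_boot all_order all_algebra.
From mathcomp Require Import spectral complex.
From mathcomp Require Import all_classical all_reals all_analysis.

Set Implicit Arguments.
Unset Strict Implicit.
Unset Printing Implicit Defensive.

Import Order.TTheory GRing.Theory Num.Theory.
Import numFieldNormedType.Exports.

Local Open Scope classical_set_scope.
Local Open Scope ring_scope.
Local Open Scope sesquilinear_scope.
Local Open Scope complex_scope.

(* The topology of R[i] given by its modulus, as for any numFieldType. *)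
HB.instance Definition _ (R : realType) := NormedModule.copy R[i] R[i]^o.

Definition inner (R : realType) (n : nat) (A B : 'M[R[i]]_n) : R[i] :=
  \tr (A ^t* *m B).

Definition real_matrix_system (R : realType) (n : nat)
    (S : set 'M[R[i]]_n) : Prop :=
  [/\ (forall (a : R) A B, S A -> S B -> S (a%:C *: A + B)),
      (forall A, S A -> S (A ^t*)) & S 1%:M].

Definition all_matrices (R : realType) (n : nat) : set 'M[R[i]]_n := setT.

Definition real_matrices (R : realType) (n : nat) : set 'M[R[i]]_n :=
  [set A | A \is a realmx].

Arguments all_matrices : clear implicits.
Arguments real_matrices : clear implicits.

Definition hermitian_part (R : realType) (n : nat) (S : set 'M[R[i]]_n) :
    set 'M[R[i]]_n :=
  S `&` [set A | A ^t* = A].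

(* For z : R[i], 0 <= z means that z is real and nonnegative. *)
Definition psd (R : realType) (n : nat) (A : 'M[R[i]]_n) : Prop :=
  A ^t* = A /\ forall v : 'cV[R[i]]_n, 0 <= (v ^t* *m A *m v) 0 0.

Definition psd_cone (R : realType) (n : nat) (S : set 'M[R[i]]_n) :
    set 'M[R[i]]_n :=
  S `&` [set A | psd A].

Definition dual_cone (R : realType) (n : nat) (S : set 'M[R[i]]_n) :
    set 'M[R[i]]_n :=
  [set A | hermitian_part S A /\ forall B, psd_cone S B -> 0 <= inner A B].

Definition states (R : realType) (n : nat) (S : set 'M[R[i]]_n) :
    set 'M[R[i]]_n :=
  [set rho | dual_cone S rho /\ \tr rho = 1].

Definition orthogonal_projection (R : realType) (n : nat)
    (S : set 'M[R[i]]_n) (p : 'M[R[i]]_n -> 'M[R[i]]_n) : Prop :=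
  [/\ (forall (a : R) A B, p (a%:C *: A + B) = a%:C *: p A + p B),
      (forall A, S (p A)) &
      (forall A B, S B -> complex.Re (inner (A - p A) B) = 0)].

(* Below, T and U are instantiated with 'M[R[i]]_n carrying the library topology
   of the entrywise sup norm, i.e. the Euclidean topology of C^(n*n). The value
   of f outside K is irrelevant, and relative_nbhs L (f x) (f @` N) requires in
   particular f @` N `<=` L. *)

(* N is a neighborhood of x in K, for the topology induced on K by T. *)
Definition relative_nbhs (T : topologicalType) (K : set T) (x : T)
    (N : set T) : Prop :=
  N `<=` K /\ within K (nbhs x) N.

(* Openness at x of the restriction f : K -> L. *)
Definition open_at (T U : topologicalType) (K : set T) (L : set U)
    (f : T -> U) (x : T) : Prop :=
  forall N, relative_nbhs K x N -> relative_nbhs L (f x) (f @` N).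

Definition open_map (T U : topologicalType) (K : set T) (L : set U)
    (f : T -> U) : Prop :=
  forall x, K x -> open_at K L f x.

Section SanityChecks.
Variables (R : realType) (n : nat).
Local Notation M := 'M[R[i]]_n.

Lemma nbhs_mxP (A : M) (P : set M) :
  nbhs A P <->
  exists2 e : R, 0 < e &
    forall B : M, (forall i j, `|A i j - B i j| < e%:C) -> P B.
Proof.
split=> [/nbhs_ballP[e /= e0 h]|[e e0 h]].
  have eE : e = (complex.Re e)%:C by rewrite RRe_real// gtr0_real.
  exists (complex.Re e) => [|B hB]; first by move: e0; rewrite {1}eE ltcR.
  by apply: h; split=> // i j; move: (hB i j); rewrite -eE.
by apply/nbhs_ballP; exists e%:C => /=; [rewrite ltcR|move=> B [_ hB]; exact: h].
Qed.

Lemma all_matrices_system : real_matrix_system (all_matrices R n).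
Proof. by []. Qed.

Lemma real_matrices_system : real_matrix_system (real_matrices R n).
Proof.
split=> [a A B /mxOverP hA /mxOverP hB|A /mxOverP hA|]; apply/mxOverP => i j.
- by rewrite !mxE rpredD// rpredM// complex_real eqxx.
- by rewrite !mxE CrealJ// hA.
- by rewrite mxE realn.
Qed.

Definition real_part (A : M) : M := map_mx (fun z => (complex.Re z)%:C) A.

Lemma innerE (A B : M) : inner A B = \sum_i \sum_j (A j i)^* * B j i.
Proof.
by apply: eq_bigr => i _; rewrite mxE; apply: eq_bigr => j _; rewrite !mxE.
Qed.

Lemma real_part_orthogonal_projection :
  orthogonal_projection (real_matrices R n) real_part.
Proof.
split=> [a A B|A|A B /mxOverP hB].
- apply/matrixP => i j; rewrite !mxE -!rmorphM -rmorphD.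
  by case: (A i j) (B i j) => [x y] [z t]; rewrite /= mul0r subr0.
- by apply/mxOverP => i j; rewrite mxE complex_real eqxx.
- rewrite innerE !raddf_sum big1// => i _; rewrite raddf_sum big1// => j _.
  rewrite !mxE; have := hB j i.
  case: (A j i) (B j i) => [x y] [z t]; rewrite complex_real => /eqP ->.
  by rewrite /= !(mulr0, mul0r, subrr, subr0).
Qed.

Lemma orthogonal_projectionE (p : M -> M) :
  orthogonal_projection (real_matrices R n) p -> p =1 real_part.
Proof.
case=> _ pR pO A; apply/matrixP => i j.
have dR : real_matrices R n (delta_mx i j).
  by apply/mxOverP => k l; rewrite mxE realn.
have := pO A _ dR; rewrite innerE (bigD1 j)//= (bigD1 i)//=.
rewrite [X in _ + X + _]big1; last first.
  by move=> k /negPf ki; rewrite !mxE ki andFb mulr0.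
rewrite [X in _ + _ + X]big1 ?addr0; last first.
  move=> k /negPf kj; rewrite big1// => l _.
  by rewrite !mxE kj andbF mulr0.
rewrite !mxE !eqxx mulr1.
have /mxOverP/(_ i j) := pR A.
case: (A i j) (p A i j) => [x y] [z t]; rewrite complex_real => /eqP -> /=.
by move/eqP; rewrite subr_eq0 => /eqP ->.
Qed.

Lemma orthogonal_projection_states (p : M -> M) :
  orthogonal_projection (real_matrices R n) p ->
  forall rho, states (all_matrices R n) rho ->
  states (real_matrices R n) (p rho).
Proof.
move=> pP rho [[[_ rhoH] rho0] rho1].
have [_ pR _] := pP; have /mxOverP pRr := pR rho.
have rE i j : (rho j i)^* = rho i j by rewrite -[in RHS]rhoH !mxE.
split; last first.
  rewrite (orthogonal_projectionE pP) /mxtrace.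
  under eq_bigr do rewrite mxE.
  by rewrite -rmorph_sum -raddf_sum -/(mxtrace rho) rho1.
split; first split; first exact: pR.
  apply/matrixP => i j; rewrite !mxE conj_Creal//.
  rewrite (orthogonal_projectionE pP) !mxE -(rE i j).
  by case: (rho j i).
move=> B [BR Bpsd].
have iB : 0 <= inner rho B by exact: rho0.
have [_ _ /(_ rho B BR)] := pP.
have -> : inner (p rho) B = (complex.Re (inner (p rho) B))%:C.
  rewrite RRe_real// innerE; apply: rpred_sum => i _; apply: rpred_sum => j _.
  by rewrite rpredM ?CrealJ//; apply/mxOverP.
have -> : inner (rho - p rho) B = inner rho B - inner (p rho) B.
  rewrite !innerE -sumrB; apply: eq_bigr => i _; rewrite -sumrB.
  by apply: eq_bigr => j _; rewrite !mxE rmorphB mulrBl.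
rewrite raddfB => /eqP; rewrite subr_eq0 => /eqP <-.
by rewrite RRe_real// ger0_real.
Qed.

End SanityChecks.

(* Main.v *)
Require Import Defs.
From mathcomp Require Import all_boot all_order all_algebra.
From mathcomp Require Import spectral complex.
From mathcomp Require Import all_classical all_reals all_analysis.
From mathcomp Require Import ring.

Import Order.TTheory GRing.Theory Num.Theory.
Import numFieldNormedType.Exports.

Local Open Scope classical_set_scope.
Local Open Scope ring_scope.

(** Write rho for a complex density matrix, sigma for its real part and
    W = rho - sigma, which is Hermitian with purely imaginary entries.  Openness
    at rho asks that every real density matrix S close to sigma be the real part
    of a density matrix close to rho.  For d > 0 let Y = (sigma + d)^-1, a real
    matrix, and take

      L(S) = S + (S Y) W (S Y)^*.

    The correction term is again purely imaginary, so Re L(S) = S and the trace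
    is unchanged.  Three facts remain.

    - Positivity.  Since rho = sigma + W >= 0, it suffices that
      S - S Y sigma Y S >= 0.  As Y sigma Y <= Y, this follows from
      S Y S <= S, which holds as soon as S <= sigma + d, hence for all S close
      to sigma, however singular sigma may be (lemma [psd_state_lift]).
    - L(sigma) is within O(d) of rho.  From rho + conj rho = 2 sigma one gets
      0 <= rho <= 2 sigma, hence W = X sigma for some X ([psd_le_submx]).  With
      T = sigma Y = 1 - d Y, so that 0 <= T <= 1, the equality
      T W T - W = - d ((X T)^* + T X T) holds, and the entries of T are bounded
      independently of d ([norm_state_lift_center]).
    - For fixed d, L is polynomial in S, so L(S) is close to L(sigma)
      ([norm_state_lift_sub]).

    Choosing d first and the neighborhood of sigma afterwards gives the theorem.
    The spectral theorem enters only through the factorization A = B^* B of a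
    positive semidefinite matrix; the same factorization identifies the density
    matrices with the positive semidefinite matrices of trace one. *)

(** * Positive semidefinite matrices *)

Section PositiveSemidefinite.
Local Open Scope sesquilinear_scope.
Context {R : realType} {n : nat}.
Implicit Types A B X : 'M[R[i]]_n.

Lemma adjmxM m k l (A : 'M[R[i]]_(m, k)) (B : 'M[R[i]]_(k, l)) :
  (A *m B) ^t* = B ^t* *m A ^t*.
Proof. by rewrite trmx_mul map_mxM. Qed.

Lemma adjmxD m k (A B : 'M[R[i]]_(m, k)) : (A + B) ^t* = A ^t* + B ^t*.
Proof. by rewrite linearD map_mxD. Qed.

Lemma adjmxN m k (A : 'M[R[i]]_(m, k)) : (- A) ^t* = - A ^t*.
Proof. by rewrite linearN map_mxN. Qed.

Lemma adjmxB m k (A B : 'M[R[i]]_(m, k)) : (A - B) ^t* = A ^t* - B ^t*.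
Proof. by rewrite adjmxD adjmxN. Qed.

Lemma adjmxZ m k (a : R[i]) (A : 'M[R[i]]_(m, k)) :
  (a *: A) ^t* = Num.conj a *: A ^t*.
Proof. by rewrite linearZ map_mxZ. Qed.

Lemma adjmx_scalar (a : R[i]) :
  a \is Num.real -> (a%:M : 'M[R[i]]_n) ^t* = a%:M.
Proof. by move=> ar; rewrite tr_scalar_mx map_scalar_mx /= conj_Creal. Qed.

Lemma gram_diagE m k (B : 'M[R[i]]_(m, k)) i :
  (B ^t* *m B) i i = \sum_j `|B j i| ^+ 2.
Proof. by rewrite mxE; apply: eq_bigr => j _; rewrite !mxE mulrC normCK. Qed.

Lemma gram_eq0 m k (B : 'M[R[i]]_(m, k)) : B ^t* *m B = 0 -> B = 0.
Proof.
move=> B0; apply/matrixP => j i; have := gram_diagE _ _ B i.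
rewrite B0 !mxE => /esym/eqP; rewrite psumr_eq0; last first.
  by move=> *; exact: exprn_ge0.
move=> /allP/(_ j); rewrite mem_index_enum sqrf_eq0 normr_eq0.
by move=> /(_ isT)/eqP.
Qed.

Lemma psd_gram m (B : 'M[R[i]]_(m, n)) : psd (B ^t* *m B).
Proof.
split=> [|v]; first by rewrite adjmxM trmxCK.
rewrite mulmxA -adjmxM -mulmxA gram_diagE.
by apply: sumr_ge0 => j _; exact: exprn_ge0.
Qed.

Lemma psdD A B : psd A -> psd B -> psd (A + B).
Proof.
move=> [hA pA] [hB pB]; split=> [|v]; first by rewrite adjmxD hA hB.
by rewrite mulmxDr mulmxDl mxE addr_ge0.
Qed.

Lemma psdZ (a : R[i]) A : 0 <= a -> psd A -> psd (a *: A).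
Proof.
move=> a0 [hA pA]; split=> [|v].
  by rewrite adjmxZ hA conj_Creal// ger0_real.
by rewrite -scalemxAr -scalemxAl mxE mulr_ge0.
Qed.

Lemma psd_congr B A : psd A -> psd (B ^t* *m A *m B).
Proof.
move=> [hA pA]; split=> [|v]; first by rewrite !adjmxM trmxCK hA mulmxA.
by have := pA (B *m v); rewrite adjmxM !mulmxA.
Qed.

Lemma psd_diag A i : psd A -> 0 <= A i i.
Proof.
move=> [_ /(_ (delta_mx i 0))]; rewrite -colE.
rewrite trmx_delta map_delta_mx -rowE.
by rewrite !mxE.
Qed.

(** With A = P^* D P the spectral decomposition, B is the matrix sqrt(D) P. *)
Lemma psd_factor A : psd A -> exists B : 'M[R[i]]_n, A = B ^t* *m B.
Proof.
move=> Apsd; have [hA _] := Apsd.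
have /hermitian_normalmx/orthomx_spectralP : A \is hermsymmx.
  by apply/is_hermitianmxP; rewrite expr0 scale1r.
set P := spectralmx A; set d := spectral_diag A => AE.
have /unitarymxP PU : P \is unitarymx := spectral_unitarymx A.
rewrite invmx_unitary ?spectral_unitarymx// in AE.
have DE : diag_mx d = P *m A *m P ^t*.
  by rewrite AE !mulmxA PU mul1mx -mulmxA PU mulmx1.
have d0 i : 0 <= d 0 i.
  have := psd_diag _ i (psd_congr (P ^t*) _ Apsd).
  by rewrite trmxCK -DE mxE eqxx.
exists (diag_mx (map_mx sqrtC d) *m P).
rewrite adjmxM tr_diag_mx map_diag_mx !mulmxA -(mulmxA (P ^t*)) mulmx_diag.
rewrite {1}AE; congr (_ *m diag_mx _ *m _); apply/rowP => i; rewrite !mxE.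
by rewrite /= conj_Creal ?sqrtC_real// -expr2 sqrtCK.
Qed.

Lemma psd_trace_mul A B : psd A -> psd B -> 0 <= \tr (A *m B).
Proof.
move=> /psd_factor[X ->] Bpsd; rewrite -mulmxA mxtrace_mulC.
apply: sumr_ge0 => i _.
by have := psd_diag _ i (psd_congr (X ^t*) _ Bpsd); rewrite trmxCK.
Qed.

Lemma ler_mul_sqrD (a b : R[i]) :
  0 <= a -> 0 <= b -> a * b <= a ^+ 2 + b ^+ 2.
Proof.
move=> a0 b0; have [ab|ba] := orP (real_leVge (ger0_real a0) (ger0_real b0)).
  by rewrite (le_trans (ler_wpM2r b0 ab))// -expr2 lerDr exprn_ge0.
by rewrite (le_trans (ler_wpM2l a0 ba))// -expr2 lerDl exprn_ge0.
Qed.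

(** A weak form of Cauchy-Schwarz, enough to turn order bounds between matrices
    into bounds on their entries. *)
Lemma psd_norm_entry A i j : psd A -> `|A i j| <= A i i + A j j.
Proof.
move=> /psd_factor[B ->]; rewrite !gram_diagE -big_split/= mxE.
rewrite (le_trans (ler_norm_sum _ _ _))//; apply: ler_sum => k _.
by rewrite !mxE normrM norm_conjC ler_mul_sqrD.
Qed.

Lemma psd_antisym A : psd A -> psd (- A) -> A = 0.
Proof.
move=> Apsd NApsd; have A0 i : A i i = 0.
  apply/le_anti; rewrite (psd_diag _ i Apsd) andbT -oppr_ge0.
  by have := psd_diag _ i NApsd; rewrite mxE.
apply/matrixP => i j; apply/eqP; rewrite mxE -normr_le0.
by have := psd_norm_entry _ i j Apsd; rewrite !A0 addr0.
Qed.

(** If 0 <= A <= B then A vanishes on the kernel of B: for a matrix K spanning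
    this kernel, both K^* A K and its opposite are positive semidefinite. *)
Lemma psd_le_submx A B : psd A -> psd (B - A) -> exists X, A = X *m B.
Proof.
move=> Apsd BApsd; apply/submxP; rewrite submxE; apply/eqP.
set K := cokermx B.
have KAK0 : K ^t* *m A *m K = 0.
  apply: psd_antisym; first exact: psd_congr.
  have := psd_congr K _ BApsd.
  by rewrite mulmxBr mulmxBl -(mulmxA _ B) mulmx_coker mulmx0 sub0r.
have [C AE] := psd_factor _ Apsd.
rewrite AE -mulmxA (_ : C *m K = 0) ?mulmx0//.
by apply: gram_eq0; rewrite adjmxM -KAK0 AE !mulmxA.
Qed.

(** For a vector v, each |v_i| |v_j| is at most |v_i|^2 + |v_j|^2, and summing
    over i and j gives 2 n |v|^2: a Hermitian matrix with small entries is
    dominated by a small multiple of the identity. *)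
Lemma psd_scalarD_hermitian (d h : R[i]) A : A ^t* = A ->
  (forall i j, `|A i j| <= h) -> h * (2 * n%:R) <= d -> 0 <= d ->
  psd (d%:M + A).
Proof.
move=> hA Ah hd d0.
split=> [|v]; first by rewrite adjmxD hA adjmx_scalar// ger0_real.
rewrite mulmxDr mulmxDl mxE mul_mx_scalar -scalemxAl mxE gram_diagE.
set s := \sum_j _; set t := (_ *m v) 0 0.
have treal : t \is Num.real.
  have conj00 (M : 'M[R[i]]_1) : Num.conj (M 0 0) = M ^t* 0 0 by rewrite !mxE.
  by apply/CrealP; rewrite /t conj00 !adjmxM trmxCK hA mulmxA.
suff : `|t| <= d * s.
  by rewrite real_ler_norml// => /andP[+ _]; rewrite -subr_ge0 opprK addrC.
have h0 (i : 'I_n) : 0 <= h by exact: le_trans (normr_ge0 _) (Ah i i).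
apply: (@le_trans _ _ (\sum_i \sum_j h * (`|v i 0| ^+ 2 + `|v j 0| ^+ 2))).
  rewrite /t mxE (le_trans (ler_norm_sum _ _ _))//; apply: ler_sum => i _.
  rewrite mxE mulr_suml (le_trans (ler_norm_sum _ _ _))//.
  apply: ler_sum => j _.
  rewrite !mxE !normrM norm_conjC mulrAC mulrC ler_pM ?mulr_ge0//.
  by rewrite addrC ler_mul_sqrD.
under eq_bigr do rewrite -mulr_sumr big_split/= sumr_const card_ord -/s.
rewrite -mulr_sumr big_split/= sumr_const card_ord sumrMnl -/s.
have s0 : 0 <= s by apply: sumr_ge0 => i _; exact: exprn_ge0.
apply: le_trans (ler_wpM2r s0 hd).
by rewrite -[s *+ n]mulr_natl le_eqVlt; apply/orP; left; apply/eqP; ring.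
Qed.

End PositiveSemidefinite.

(** * The resolvent and the lift *)

(** Identities between sums of matrices hold entrywise by commutative algebra
    once the matrix products in them are treated as indeterminates. *)
Ltac mx_abel :=
  repeat match goal with |- context [?A *m ?B] =>
    let P := fresh "P" in set P := (A *m B); clearbody P end;
  apply/matrixP => ? ?; rewrite !mxE; ring.

Section Resolvent.
Local Open Scope sesquilinear_scope.
Context {R : realType} {n : nat}.
Implicit Types (A S W X Y : 'M[R[i]]_n) (d : R[i]).

Lemma psd1 : psd (1%:M : 'M[R[i]]_n).
Proof.
have := psd_gram _ (1%:M : 'M[R[i]]_n).
by rewrite mulmx1 adjmx_scalar ?real1.
Qed.

Lemma psd_scalar d : 0 <= d -> psd (d%:M : 'M[R[i]]_n).
Proof. by move=> d0; rewrite -scalemx1; apply: psdZ psd1. Qed.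

Lemma psd_shift_unit A d : psd A -> 0 < d -> A + d%:M \in unitmx.
Proof.
move=> [_ pA] d0; rewrite -row_free_unit; apply: inj_row_free => v vAd.
rewrite -[v]trmxCK; set w := v ^t*.
suff -> : w = 0 by rewrite trmx0 map_mx0.
apply: gram_eq0; apply/matrixP => i j; rewrite !ord1 [RHS]mxE.
have : (w ^t* *m (A + d%:M) *m w) 0 0 = 0.
  by rewrite trmxCK vAd mul0mx mxE.
rewrite mulmxDr mulmxDl mxE mul_mx_scalar -scalemxAl [X in _ + X]mxE => /eqP.
have g0 : 0 <= (w ^t* *m w) 0 0.
  by rewrite gram_diagE; apply: sumr_ge0 => k _; exact: exprn_ge0.
rewrite paddr_eq0 ?mulr_ge0 ?(ltW d0)// => /andP[_].
by rewrite mulf_eq0 gt_eqF//= => /eqP.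
Qed.

Definition resolvent A d := invmx (A + d%:M).

Section Bounds.
Context (A : 'M[R[i]]_n) (d : R[i]) (Apsd : psd A) (d0 : 0 < d).
Local Notation Y := (resolvent A d).

Let dR : d \is Num.real. Proof. exact: gtr0_real. Qed.

Lemma resolvent_adj : Y ^t* = Y.
Proof.
by rewrite /resolvent trmx_inv map_invmx adjmxD adjmx_scalar// (proj1 Apsd).
Qed.

Lemma resolventK : (A + d%:M) *m Y = 1%:M.
Proof. exact/mulmxV/psd_shift_unit. Qed.

Lemma resolvent_eq : Y *m (A + d%:M) *m Y = Y.
Proof. by rewrite -mulmxA resolventK mulmx1. Qed.

Lemma mul_resolventE : A *m Y = 1%:M - d *: Y.
Proof. by rewrite -resolventK mulmxDl mul_scalar_mx addrK. Qed.

Lemma psd_resolvent : psd Y.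
Proof.
rewrite -resolvent_eq -{1}resolvent_adj; apply: psd_congr.
by apply: psdD => //; apply: psd_scalar; exact: ltW.
Qed.

Lemma psd_mul_resolvent : psd (A *m Y).
Proof.
have -> : A *m Y = Y ^t* *m (A ^t* *m A + d *: A) *m Y.
  rewrite resolvent_adj (proj1 Apsd).
  have -> : A *m A + d *: A = (A + d%:M) *m A by rewrite mulmxDl mul_scalar_mx.
  by rewrite mulmxA /resolvent mulVmx ?mul1mx// psd_shift_unit.
apply: psd_congr; apply: psdD; first exact: psd_gram.
by apply: psdZ => //; exact: ltW.
Qed.

(** The bound comes from 0 <= A Y <= 1, so it does not depend on d. *)
Lemma norm_mul_resolvent i j : `|(A *m Y) i j| <= 2.
Proof.
have diag_le1 k : (A *m Y) k k <= 1.
  have := psd_diag _ k (psdZ _ _ (ltW d0) psd_resolvent).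
  by rewrite mul_resolventE !mxE eqxx lerBlDr lerDl.
rewrite (le_trans (psd_norm_entry _ i j psd_mul_resolvent))//.
by rewrite -[2]/(1 + 1) lerD.
Qed.

End Bounds.

(** For Hermitian S and Y the second term is (S Y) W (S Y)^*. *)
Definition state_lift Y W S := S + S *m Y *m W *m Y *m S.

(** The lift is a sum of four positive semidefinite matrices, the last three of
    which add up to S - S Y A Y S. *)
Lemma psd_state_lift A W Y S d :
  Y ^t* = Y -> Y *m (A + d%:M) *m Y = Y -> 0 <= d ->
  psd S -> psd (A + W) -> psd (A + d%:M - S) -> psd (state_lift Y W S).
Proof.
move=> hY eY d0 Spsd AWpsd near.
have hS := proj1 Spsd.
have -> : state_lift Y W S =
    (Y *m S) ^t* *m (A + W) *m (Y *m S)
  + (1%:M - Y *m S) ^t* *m S *m (1%:M - Y *m S)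
  + (Y *m S) ^t* *m (A + d%:M - S) *m (Y *m S)
  + d *: ((Y *m S) ^t* *m (Y *m S)).
  have E : S *m Y *m S = S *m Y *m A *m Y *m S + d *: (S *m Y *m Y *m S).
    rewrite -[in LHS]eY mulmxDr mulmxDl mul_mx_scalar -scalemxAl.
    by rewrite mulmxDr mulmxDl -scalemxAr -scalemxAl !mulmxA.
  rewrite adjmxB !adjmxM hS hY adjmx_scalar ?real1//.
  rewrite !(mulmxDr, mulmxDl, mulmxN, mulNmx, mulmx1, mul1mx, mul_mx_scalar).
  rewrite -!scalemxAl !mulmxA /state_lift E.
  by mx_abel.
by do !apply: psdD; try exact: psd_congr; apply: psdZ => //; exact: psd_gram.
Qed.

(** * Estimates on the lift *)

Definition entry_norm X : R[i] := \sum_k \sum_l `|X k l|.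

Lemma entry_norm_ge0 X : 0 <= entry_norm X.
Proof. by apply: sumr_ge0 => k _; apply: sumr_ge0. Qed.

Lemma norm_entry_mulmx3 (A X B : 'M[R[i]]_n) (a b : R[i]) i j :
  (forall k l, `|A k l| <= a) -> (forall k l, `|B k l| <= b) ->
  `|(A *m X *m B) i j| <= a * b * entry_norm X.
Proof.
move=> Aa Bb; rewrite mxE (le_trans (ler_norm_sum _ _ _))//.
rewrite /entry_norm exchange_big mulr_sumr; apply: ler_sum => l _.
rewrite mxE mulr_suml (le_trans (ler_norm_sum _ _ _))// mulr_sumr.
apply: ler_sum => k _.
by rewrite !normrM mulrAC ler_wpM2r// ler_pM.
Qed.

Lemma norm_entry_scalar1 (i j : 'I_n) : `|(1%:M : 'M[R[i]]_n) i j| <= 1.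
Proof. by rewrite mxE; case: (i == j); rewrite ?normr1 ?normr0. Qed.

(** The difference to the target A + W is - d ((X T)^* + T X T) for T = A Y,
    and the entries of T are at most 2: hence the constant 6 = 2 + 2 * 2. *)
Lemma norm_state_lift_center A W X d i j :
  psd A -> 0 < d -> W = X *m A -> W ^t* = W ->
  `|(state_lift (resolvent A d) W A - (A + W)) i j| <= d * (6 * entry_norm X).
Proof.
move=> Apsd d0 WX hW; set Y := resolvent A d; set T := A *m Y.
have hY : Y ^t* = Y by exact: resolvent_adj.
have hA := proj1 Apsd.
have TE : T = 1%:M - d *: Y by exact: mul_resolventE.
have hT : T ^t* = T by have [] := psd_mul_resolvent _ _ Apsd d0.
have YAT : Y *m A = T by rewrite -hT adjmxM hY hA.
have WY : W *m Y = X *m T by rewrite WX -mulmxA.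
have YW : Y *m W = (X *m T) ^t* by rewrite -WY adjmxM hW hY.
have -> : state_lift Y W A - (A + W) = - (d *: ((X *m T) ^t* + T *m X *m T)).
  rewrite /state_lift -/T -(mulmxA _ Y) YAT opprD addrACA subrr add0r.
  have -> : T *m W *m T - W = - (d *: (Y *m W + T *m (W *m Y))).
    rewrite {2}TE mulmxBr mulmx1 -scalemxAr {1}TE mulmxBl mul1mx -scalemxAl.
    rewrite scalerDr mulmxA.
    by mx_abel.
  by rewrite YW WY mulmxA.
rewrite mxE normrN mxE normrM gtr0_norm//; apply: ler_wpM2l; first exact: ltW.
have T2 k l : `|T k l| <= 2 by exact: norm_mul_resolvent.
have := norm_entry_mulmx3 T X T 2 2 i j T2 T2.
have := norm_entry_mulmx3 1%:M X T 1 2 j i norm_entry_scalar1 T2.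
rewrite mul1mx => h1 h2; rewrite mxE (le_trans (ler_normD _ _))//.
have -> : 6 * entry_norm X = 1 * 2 * entry_norm X + 2 * 2 * entry_norm X by ring.
by apply: lerD => //; rewrite !mxE norm_conjC; move: h1; rewrite mxE.
Qed.

(** Expansion in powers of D = S - A; the bound h <= 1 makes the quadratic term
    linear in h. *)
Lemma norm_state_lift_sub A W Y S Q (h : R[i]) i j : Q = Y *m W *m Y ->
  h <= 1 -> (forall k l, `|(S - A) k l| <= h) ->
  `|(state_lift Y W S - state_lift Y W A) i j| <=
  h * (1 + (entry_norm Q + entry_norm (Q *m A) + entry_norm (A *m Q))).
Proof.
move=> QE h1 Dh; set D := S - A in Dh *.
have -> : state_lift Y W S - state_lift Y W A =
    D + (D *m Q *m D + D *m (Q *m A) *m 1%:M + 1%:M *m (A *m Q) *m D).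
  have -> : S = A + D by rewrite addrC subrK.
  rewrite /state_lift -!(mulmxA _ Y W) -!(mulmxA _ (Y *m W) Y) -!QE.
  rewrite mulmx1 mul1mx !(mulmxDl, mulmxDr) !mulmxA.
  by mx_abel.
have h0 : 0 <= h by exact: le_trans (normr_ge0 _) (Dh i j).
have q0 := entry_norm_ge0 Q.
rewrite mxE (le_trans (ler_normD _ _))// mulrDr mulr1 lerD//.
rewrite mxE (le_trans (ler_normD _ _))// mulrDr lerD//; last first.
  rewrite -[h]mul1r; apply: norm_entry_mulmx3 => //; exact: norm_entry_scalar1.
rewrite mxE (le_trans (ler_normD _ _))// mulrDr lerD//; last first.
  rewrite -[h]mulr1; apply: norm_entry_mulmx3 => //; exact: norm_entry_scalar1.
rewrite (le_trans (norm_entry_mulmx3 _ _ _ _ _ _ _ Dh Dh))//.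
by rewrite ler_wpM2r// ler_piMr.
Qed.

End Resolvent.

(** * Density matrices and their real parts *)

Section States.
Local Open Scope sesquilinear_scope.
Context {R : realType} {n : nat}.
Implicit Types A B S rho sigma : 'M[R[i]]_n.

Local Notation entry_conj A := (map_mx Num.conj A).

Lemma psd_entry_conj A : psd A -> psd (entry_conj A).
Proof.
move=> /psd_factor[B ->]; rewrite map_mxM.
have -> : entry_conj (B ^t*) = (entry_conj B) ^t* by rewrite -!map_trmx.
exact: psd_gram.
Qed.

Lemma real_partE A : 2 *: real_part A = A + entry_conj A.
Proof.
apply/matrixP => i j; rewrite !mxE; case: (A i j) => x y.
by apply/eqP; rewrite mulr_natl mulr2n eq_complex /= subrr addr0 !eqxx.
Qed.

Lemma entry_conj_real_part A : entry_conj (real_part A) = real_part A.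
Proof. by apply/matrixP => i j; rewrite !mxE /= conj_Creal// complex_real. Qed.

Lemma psd_real_part A : psd A -> psd (real_part A).
Proof.
move=> Apsd; have -> : real_part A = 2^-1 *: (A + entry_conj A).
  by rewrite -real_partE scalerA mulVf ?scale1r// pnatr_eq0.
by apply: psdZ; [rewrite invr_ge0 ler0n|exact/psdD/psd_entry_conj].
Qed.

Lemma mxtrace_real_part A : A ^t* = A -> \tr (real_part A) = \tr A.
Proof.
move=> hA; have two0 : (2 : R[i]) != 0 by rewrite pnatr_eq0.
apply: (mulfI two0); rewrite -mxtraceZ real_partE mxtraceD.
have -> : entry_conj A = A^T.
  by apply/matrixP => i j; rewrite -[in LHS]hA !mxE conjCK.
by rewrite mxtrace_tr mulr_natl mulr2n.
Qed.

Lemma mxtrace_mul_outer A (v : 'cV[R[i]]_n) :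
  \tr (A *m (v *m v ^t*)) = (v ^t* *m A *m v) 0 0.
Proof. by rewrite mulmxA mxtrace_mulC mulmxA /mxtrace big_ord1. Qed.

Lemma psd_outer (v : 'cV[R[i]]_n) : psd (v *m v ^t*).
Proof. by rewrite -{1}[v]trmxCK; exact: psd_gram. Qed.

Lemma states_allP rho :
  states (all_matrices R n) rho <-> psd rho /\ \tr rho = 1.
Proof.
split=> [[[[_ hrho] dual] tr1]|[rhopsd tr1]].
  split=> //; split=> // v.
  rewrite -mxtrace_mul_outer -[in X in \tr X]hrho.
  by apply: dual; split=> //; exact: psd_outer.
split=> //; split; first by split=> //; case: rhopsd.
by move=> B [_ Bpsd]; rewrite /inner (proj1 rhopsd); exact: psd_trace_mul.
Qed.

(** For a complex vector v, the test matrix v v^* need not be real, but it may be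
    replaced by P + conj P with P = v v^*: as S is real and Hermitian, both terms
    have the same pairing with S. *)
Lemma states_real_psd S : states (real_matrices R n) S ->
  [/\ psd S, entry_conj S = S & \tr S = 1].
Proof.
move=> [[[/realmxC cS hS] dual] tr1]; split=> //; split=> // v.
pose P := v *m v ^t*.
have : 0 <= inner S (P + entry_conj P).
  apply: dual; split; last first.
    by apply: psdD; [|apply: psd_entry_conj]; exact: psd_outer.
  rewrite -real_partE; apply/mxOverP => i j.
  by rewrite !mxE rpredM ?realn// complex_real.
rewrite /inner hS mulmxDr mxtraceD.
have -> : \tr (S *m entry_conj P) = \tr (S *m P).
  rewrite -[in LHS]cS -map_mxM.
  have -> : entry_conj (S *m P) = ((S *m P) ^t*)^T by rewrite -map_trmx trmxK.
  have [hP _] : psd P := psd_outer v.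
  by rewrite mxtrace_tr adjmxM hS hP mxtrace_mulC.
by rewrite -mulr2n pmulrn_lge0// mxtrace_mul_outer.
Qed.

Lemma states_state_lift rho S (d : R[i]) :
  let sigma := real_part rho in
  let L := state_lift (resolvent sigma d) (rho - sigma) S in
  0 < d -> psd rho -> states (real_matrices R n) S ->
  psd (sigma + d%:M - S) -> states (all_matrices R n) L /\ real_part L = S.
Proof.
move=> sigma L d0 rhopsd /states_real_psd[Spsd cS trS] near.
have spsd : psd sigma by exact: psd_real_part.
have Lpsd : psd L.
  apply: (psd_state_lift sigma _ _ _ d) => //.
  - exact: resolvent_adj.
  - exact: resolvent_eq.
  - exact: ltW.
  - by rewrite addrC subrK.
have cs : entry_conj sigma = sigma by exact: entry_conj_real_part.
have cY : entry_conj (resolvent sigma d) = resolvent sigma d.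
  rewrite /resolvent map_invmx map_mxD map_scalar_mx cs /=.
  by rewrite conj_Creal// gtr0_real.
have cW : entry_conj (rho - sigma) = - (rho - sigma).
  rewrite map_mxB cs -(addKr rho (entry_conj rho)) -real_partE.
  by rewrite scaler_nat mulr2n -/sigma addrA addrK addrC opprB.
have LS : real_part L = S.
  have two0 : (2 : R[i]) != 0 by rewrite pnatr_eq0.
  apply: (scalerI two0); rewrite real_partE /L /state_lift map_mxD.
  rewrite !map_mxM cS cY cW.
  rewrite mulmxN !mulNmx addrACA subrr addr0.
  by rewrite scaler_nat mulr2n.
split=> //; apply/states_allP; split=> //.
by rewrite -mxtrace_real_part ?LS//; case: Lpsd.
Qed.

(** * Openness of the projection *)

Lemma exists_small (a b x y : R[i]) : 0 <= a -> 0 < x -> 0 <= b -> 0 < y ->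
  exists2 h, 0 < h & [/\ h <= 1, h * a < x & h * b < y].
Proof.
move=> a0 x0 b0 y0; set c := 1 + a / x + b / y.
have ax : 0 <= a / x by rewrite divr_ge0// ltW.
have bx : 0 <= b / y by rewrite divr_ge0// ltW.
have c0 : 0 < c by rewrite /c -addrA ltr_pwDl// addr_ge0.
exists c^-1; first by rewrite invr_gt0.
split.
- by rewrite invf_le1// /c -addrA lerDl addr_ge0.
- rewrite mulrC ltr_pdivrMr// -ltr_pdivrMl// mulrC /c.
  by rewrite addrAC ltrDr ltr_pwDl.
- rewrite mulrC ltr_pdivrMr// -ltr_pdivrMl// mulrC /c.
  by rewrite ltrDr ltr_pwDl.
Qed.

(** Complex radii spare conversions: the estimates above are inequalities between
    complex numbers that happen to be real. *)
Lemma nbhs_mx_complexP A (P : set 'M[R[i]]_n) :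
  nbhs A P <->
  exists2 e : R[i], 0 < e & forall B, (forall i j, `|A i j - B i j| < e) -> P B.
Proof.
rewrite nbhs_mxP; split=> [[e e0 h]|[e e0 h]].
  by exists (e%:C)%C => //; rewrite ltcR.
have eE : e = (complex.Re e)%:C%C by rewrite RRe_real// gtr0_real.
exists (complex.Re e) => [|B]; first by move: e0; rewrite {1}eE ltcR.
by rewrite -eE; exact: h.
Qed.

End States.

Theorem proposition7p1 (R : realType) (n : nat) (n_ge1 : (1 <= n)%N)
    (p : 'M[R[i]]_n -> 'M[R[i]]_n)
    (p_proj : orthogonal_projection (real_matrices R n) p) :
  open_map (states (all_matrices R n)) (states (real_matrices R n)) p.
Proof.
move=> rho rhoK N [NK /nbhs_mx_complexP[e e0 eN]].
have pE := orthogonal_projectionE p_proj.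
have [rhopsd _] := (states_allP rho).1 rhoK.
split=> [_ [A /NK AK <-]|]; first exact: orthogonal_projection_states.
rewrite pE; set sigma := real_part rho; set W := rho - sigma.
have spsd : psd sigma by exact: psd_real_part.
have [X WX] : exists X, W = X *m sigma.
  (* 2 sigma - rho is the entrywise conjugate of rho. *)
  have [|X rhoX] := psd_le_submx rho (2 *: sigma) rhopsd.
    by rewrite real_partE addrC addKr; exact: psd_entry_conj.
  exists (2 *: X - 1%:M).
  by rewrite mulmxBl mul1mx -scalemxAl scalemxAr -rhoX.
have hW : (map_mx Num.conj W^T) = W.
  by rewrite adjmxB (proj1 rhopsd) (proj1 spsd).
have e20 : 0 < e / 2 by rewrite divr_gt0.
(* d is fixed here; the radius h of the neighborhood of sigma depends on it. *)
have [d d0 [_ dX _]] := exists_small (6 * entry_norm X) 0 _ 1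
  (mulr_ge0 (ler0n _ 6) (entry_norm_ge0 X)) e20 (lexx 0) ltr01.
set Y := resolvent sigma d; set Q := Y *m W *m Y.
set c := 1 + (entry_norm Q + entry_norm (Q *m sigma) + entry_norm (sigma *m Q)).
have c0 : 0 <= c by rewrite !addr_ge0// entry_norm_ge0.
have [h h0 [h1 hc hd]] := exists_small c (2 * n%:R) _ _ c0 e20
  (mulr_ge0 (ler0n _ 2) (ler0n _ n)) d0.
apply/nbhs_mx_complexP; exists h => // S Sh SL.
have near : psd (sigma + d%:M - S).
  rewrite addrAC addrC.
  apply: (psd_scalarD_hermitian _ h) => [|i j||]; last 2 first.
  - exact: ltW.
  - exact: ltW.
  - have [[hS _] _ _] := states_real_psd _ SL.
    by rewrite adjmxB hS (proj1 spsd).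
  - by have := Sh i j; rewrite !mxE => /ltW.
have [LK LS] := states_state_lift rho S d d0 rhopsd SL near.
exists (state_lift Y W S); last by rewrite pE.
apply: eN => // i j.
have sW : sigma + W = rho by rewrite addrC subrK.
have := norm_state_lift_center sigma W X d i j spsd d0 WX hW.
rewrite sW -/Y => close.
have Dh k l : `|(S - sigma) k l| <= h.
  by have := Sh k l; rewrite distrC !mxE => /ltW.
have := norm_state_lift_sub sigma W Y S Q h i j erefl h1 Dh.
rewrite -/c => cont.
rewrite distrC [e]splitr.
have -> : state_lift Y W S i j - rho i j =
    (state_lift Y W S - state_lift Y W sigma) i j
    + (state_lift Y W sigma - rho) i j.
  by rewrite !mxE; ring.
rewrite (le_lt_trans (ler_normD _ _))// ltrD//.
- exact: le_lt_trans cont hc.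
- exact: le_lt_trans close dX.
Qed.
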